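(* For every integer $n\ge 0$ the polynomial $P_n=P_{-4,n}(c)$ satisfies the following fourth order linear differential equation, where $'$ denotes differentiation with respect to $c$: $$16(c^2-1)^2P_n^{(iv)}+160c(c^2-1)P_n'''-8\left(c^2(n^2-4n-46)-n^2+4n+22\right)P_n''-24c(n^2-4n-6)P_n'+(n-4)^2n^2P_n=0.$$
   Context: The polynomials $P_{-4,n}(c)$, $n\ge 0$, in the variable $c$ (complex coefficients) are defined by the initial conditions $P_{-4,0}(c)=1$, $P_{-4,1}(c)=P_{-4,2}(c)=P_{-4,3}(c)=0$ and the recursion $$(6+2k)P_{-4,k+4}(c)=4k\,c\,P_{-4,k+2}(c)-2(k-3)P_{-4,k}(c),\qquad k\ge 0.$$ Thus, for example, $P_{-4,4}=1$, $P_{-4,6}=\frac{4c}{5}$, $P_{-4,8}=\frac{32c^2-5}{35}$, and all odd-indexed polynomials vanish. Their generating function is $\sum_{n\ge0}P_{-4,n}(c)z^n=z\sqrt{1-2cz^2+z^4}\int\frac{4cz^2-1}{z^2(z^4-2cz^2+1)^{3/2}}\,dz$. *)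

(* Defs.v *)
From mathcomp Require Import all_boot all_order all_algebra.
Set Implicit Arguments.
Unset Strict Implicit.
Unset Printing Implicit Defensive.
Import Order.TTheory GRing.Theory Num.Theory.
Local Open Scope ring_scope.

(* The variable c is the polynomial indeterminate 'X. In the last case the
   index is k + 4 and m is k + 2; Pm4_rec below is the defining recursion with
   the factor 6 + 2k not divided out. *)
Fixpoint Pm4 (F : numFieldType) (n : nat) : {poly F} :=
  match n with
  | 0 => 1
  | 1 | 2 | 3 => 0
  | ((k.+2) as m).+2 =>
      (6 + 2 * k%:R)^-1 *:
        ((4 * k%:R) *: ('X * Pm4 F m) - (2 * (k%:R - 3)) *: Pm4 F k)
  end.

Lemma Pm4_rec (F : numFieldType) (k : nat) :
  (6 + 2 * k%:R) *: Pm4 F k.+4 =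
  (4 * k%:R) *: ('X * Pm4 F k.+2) - (2 * (k%:R - 3)) *: Pm4 F k.
Proof.
rewrite [Pm4 F k.+4]/= scalerA divff ?scale1r //.
by rewrite -natrM -natrD pnatr_eq0.
Qed.

(* Main.v *)
Require Import Defs.
From mathcomp Require Import all_boot all_order all_algebra.
From mathcomp Require Import ring.
From mathcomp Require Import reals complex.
Import Order.TTheory GRing.Theory Num.Theory.
Local Open Scope ring_scope.

(** The recursion is that of associated ultraspherical polynomials: it is the
    contiguity relation satisfied by the Gegenbauer functions u_n of parameter
    -1/2 and of degree (n - 1) / 2. Write w = c^2 - 1. These functions satisfy
    the first-order relation D u = 0, where

      (D p)_n = 2 w p_n' + (n - 3) c p_n - (n + 1) p_(n+2),

    and they satisfy 4 w u_n'' = (n - 1) (n - 3) u_n. The polynomials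
    P_n = a u_n + b v_n combine two of them with coefficients a, b that depend
    on c but not on n, so (D P)_n = 2 w (a' u_n + b' v_n) again solves the
    recursion. Since a and b solve one second-order equation,
    4 w a'' + 16 c a' + 9 a = 0, so do the products, which is why an equation
    of order 2 * 2 = 4 is to be expected.

    None of these functions is needed to run the argument on polynomials.
    The operator D maps solutions of the recursion to solutions
    ([solution_shift_deriv]), by differentiating the recursion. Hence
    D (D P) + 4 c D P + 9 w P is a solution; its first four terms vanish, so
    it is zero ([shift_deriv2_Pm4]). Put R = D P. The definition of R and this
    identity express the derivatives of P_n, P_(n+2), R_n, R_(n+2) linearly in
    these four polynomials. Eliminating P_(n+2) and R_(n+2), each time with a
    factor w to cancel, gives with T_n = 4 w P_n'' - (n^2 - 4 n - 6) P_n

      4 R_n' = T_n - 18 P_n                   ([deriv_shift_deriv_Pm4]),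
      2 (n - 2)^2 R_n = 2 w T_n' + 8 c T_n + 36 w P_n' - 72 c P_n
                                              ([deriv_shift_gegenbauer_Pm4]).

    Differentiating the second relation and inserting the first eliminates
    R_n and leaves the stated equation for P_n. *)

Section LinearCombination.

Context {R : comPzRingType}.
Implicit Types x y z t : R.

(** These lemmas derive an equation from a linear combination of known ones
    whose coefficients are given explicitly, so that only a polynomial
    identity is left. *)
Lemma eq_lincomb {x y z t} : z = t -> x - y = z - t -> x = y.
Proof. by move=> ->; rewrite subrr => /subr0_eq. Qed.

Lemma eq_mull z {x y} : x = y -> z * x = z * y.
Proof. by move=> ->. Qed.

Lemma eq_add {x y z t} : x = y -> z = t -> x + z = y + t.
Proof. by move=> -> ->. Qed.

End LinearCombination.

Section Recursion.

Variable F : numFieldType.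
Implicit Types (p : nat -> {poly F}) (a : {poly F}).

Local Notation w := ('X ^+ 2 - 1 : {poly F}).

Lemma polynatrS_neq0 k : (k.+1%:R : {poly F}) != 0.
Proof. by rewrite -polyC_natr polyC_eq0 pnatr_eq0. Qed.

Lemma polynatrD3_neq0 k : (k%:R + 3 : {poly F}) != 0.
Proof. by rewrite -natrD addn3 polynatrS_neq0. Qed.

Lemma deriv_natr k : (k%:R : {poly F})^`() = 0.
Proof. by rewrite -polyC_natr derivC. Qed.

Lemma X2B1_neq0 : w != 0.
Proof. by rewrite -size_poly_eq0 -polyC1 size_XnsubC. Qed.

Lemma derivX2B1 : w^`() = 2 * 'X.
Proof. by rewrite derivB derivXn -polyC1 derivC; ring. Qed.

Let derivE := (derivX2B1, derivM, derivD, derivN, derivX, deriv_natr,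
  deriv_natr 1, derivC).

Definition solution p := forall k,
  (k%:R + 3) * p k.+4 = 2 * k%:R * 'X * p k.+2 - (k%:R - 3) * p k.

Lemma solution_Pm4 : solution (Pm4 F).
Proof.
move=> k; apply: (mulfI (polynatrS_neq0 1)).
have := Pm4_rec F k.
rewrite -!mul_polyC !(rmorphD, rmorphB, rmorphM, rmorph_nat) => rec.
by apply: (eq_lincomb rec); ring.
Qed.

Lemma solutionD p q : solution p -> solution q -> solution (fun k => p k + q k).
Proof. by move=> sp sq k; rewrite mulrDr sp sq; ring. Qed.

Lemma solutionM a p : solution p -> solution (fun k => a * p k).
Proof. by move=> sp k; rewrite mulrCA sp; ring. Qed.

(** The leading coefficient k + 3 of the recursion never vanishes, so four
    initial values determine a solution. *)
Lemma solution_eq0 p : solution p ->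
  p 0%N = 0 -> p 1%N = 0 -> p 2%N = 0 -> p 3%N = 0 -> forall k, p k = 0.
Proof.
move=> sp p0 p1 p2 p3 k.
suff: [/\ p k = 0, p k.+1 = 0, p k.+2 = 0 & p k.+3 = 0] by case.
elim: k => [//|k [pk pk1 pk2 pk3]]; split=> //.
apply: (mulfI (polynatrD3_neq0 k)).
by rewrite sp pk pk2; ring.
Qed.

(** This is the operator D above, which annihilates the Gegenbauer functions.
    It is locked so that the rules for derivatives do not rewrite inside it. *)
Definition shift_deriv p k :=
  locked (2 * w * (p k)^`() + (k%:R - 3) * 'X * p k - (k%:R + 1) * p k.+2).

Lemma shift_derivE p k : shift_deriv p k =
  2 * w * (p k)^`() + (k%:R - 3) * 'X * p k - (k%:R + 1) * p k.+2.
Proof. by rewrite /shift_deriv -lock. Qed.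

(** Differentiating the recursion at k gives an inhomogeneous recursion for the
    derivatives; the shift terms of the operator compensate the extra term,
    by the recursion at k + 2 and at k. *)
Lemma solution_shift_deriv p : solution p -> solution (shift_deriv p).
Proof.
move=> sp k; rewrite !shift_derivE.
have d0 := congr1 (@deriv F) (sp k); rewrite !derivE in d0.
apply: (eq_lincomb (eq_add (eq_mull (2 * w) d0)
  (eq_add (eq_mull (- (k%:R + 3)) (sp k.+2))
          (eq_mull ((k%:R - 3) * 'X) (sp k))))).
ring.
Qed.

Local Notation r := (shift_deriv (Pm4 F)).

(** The constants 4 and 9 are forced by the initial values: the term with k = 2
    gives 4, and then the term with k = 0 gives 9. *)
Lemma shift_deriv2_Pm4 k :
  shift_deriv r k + (4 * 'X * r k + 9 * w * Pm4 F k) = 0.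
Proof.
have sP := solution_Pm4; have sr := solution_shift_deriv _ sP.
have r0 : r 0%N = - (3 * 'X) by rewrite shift_derivE /= !derivE; ring.
have r1 : r 1%N = 0.
  by rewrite shift_derivE [Pm4 F 3]/= [Pm4 F 1]/= !derivE; ring.
have P4 : Pm4 F 4 = 1.
  apply: (mulfI (polynatrD3_neq0 0)).
  by rewrite sP [Pm4 F 2]/= [Pm4 F 0]/=; ring.
have P5 : Pm4 F 5 = 0.
  apply: (mulfI (polynatrD3_neq0 1)).
  by rewrite sP [Pm4 F 3]/= [Pm4 F 1]/=; ring.
have r2 : r 2%N = - 3.
  by rewrite shift_derivE P4 [Pm4 F 2]/= !derivE; ring.
have r3 : r 3%N = 0.
  by rewrite shift_derivE P5 [Pm4 F 3]/= !derivE; ring.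
have r4 : r 4%N = - (3 * 'X).
  by apply: (mulfI (polynatrD3_neq0 0)); rewrite sr r2 r0; ring.
have r5 : r 5%N = 0.
  by apply: (mulfI (polynatrD3_neq0 1)); rewrite sr r3 r1; ring.
move: k; apply: solution_eq0.
- apply: solutionD; first exact: solution_shift_deriv.
  by apply: solutionD; apply: solutionM.
- by rewrite [shift_deriv r 0]shift_derivE r0 r2 [Pm4 F 0]/= !derivE; ring.
- by rewrite [shift_deriv r 1]shift_derivE r1 r3 [Pm4 F 1]/= !derivE; ring.
- by rewrite [shift_deriv r 2]shift_derivE r2 r4 [Pm4 F 2]/= !derivE; ring.
- by rewrite [shift_deriv r 3]shift_derivE r3 r5 [Pm4 F 3]/= !derivE; ring.
Qed.

(** The Gegenbauer operator is 4 w a'' - (n - 1) (n - 3) a; adding 9 a gives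
    the quotient by w that appears in [shift_gegenbauer_Pm4]. It is locked for
    the same reason as [shift_deriv]. *)
Definition shift_gegenbauer (n : nat) a :=
  locked (4 * w * a^`()^`() - (n%:R ^+ 2 - 4 * n%:R - 6) * a).

Lemma shift_gegenbauerE n a : shift_gegenbauer n a =
  4 * w * a^`()^`() - (n%:R ^+ 2 - 4 * n%:R - 6) * a.
Proof. by rewrite /shift_gegenbauer -lock. Qed.

Local Notation T n := (shift_gegenbauer n (Pm4 F n)).

(** Differentiate the definition of [r n], multiply by 2 w, and remove the
    derivatives of [r n] by [shift_deriv2_Pm4] and of [Pm4 F n.+2] by the
    definition of [r n.+2]. *)
Lemma shift_gegenbauer_Pm4 n :
  w * T n = 2 * (n%:R + 1) * (r n.+2 - 'X * r n).
Proof.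
have e0 := shift_derivE (Pm4 F) n; have e2 := shift_derivE (Pm4 F) n.+2.
have L := shift_deriv2_Pm4 n; rewrite [shift_deriv r n]shift_derivE in L.
have d0 := congr1 (@deriv F) e0; rewrite !derivE in d0.
apply: (eq_lincomb (eq_add (eq_mull (- (2 * w)) d0)
  (eq_add L (eq_add (eq_mull (- (n%:R + 1)) e2)
  (eq_add (eq_mull (n%:R + 1) (solution_Pm4 n))
          (eq_mull ((n%:R + 1) * 'X) e0)))))).
rewrite shift_gegenbauerE.
ring.
Qed.

(** The part of [r n]' that involves [r n] and [r n.+2] is, by
    [shift_deriv2_Pm4], a multiple of the right-hand side in
    [shift_gegenbauer_Pm4], hence divisible by w. *)
Lemma deriv_shift_deriv_Pm4 n : 4 * (r n)^`() = T n - 18 * Pm4 F n.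
Proof.
have w2_neq0 : 2 * w != 0 by rewrite mulf_neq0 ?X2B1_neq0 ?polynatrS_neq0.
apply: (mulfI w2_neq0).
have L := shift_deriv2_Pm4 n; rewrite [shift_deriv r n]shift_derivE in L.
apply: (eq_lincomb
  (eq_add (eq_mull 4 L) (eq_mull (- 2) (shift_gegenbauer_Pm4 n)))).
ring.
Qed.

(** Differentiating [shift_gegenbauer_Pm4] brings in [r n.+2]', which
    [shift_deriv2_Pm4] at n + 2 expresses through [r n.+2] and [r n.+4]; the
    recursion for [r] removes [r n.+4], [shift_gegenbauer_Pm4] removes
    [r n.+2], and the definition of [r n] removes [Pm4 F n.+2]. *)
Lemma deriv_shift_gegenbauer_Pm4 n :
  2 * w * (T n)^`() + 8 * 'X * T n + 36 * w * (Pm4 F n)^`() - 72 * 'X * Pm4 F n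
  = 2 * (n%:R - 2) ^+ 2 * r n.
Proof.
apply: (mulfI X2B1_neq0).
have e0 := shift_derivE (Pm4 F) n.
have L := shift_deriv2_Pm4 n; rewrite [shift_deriv r n]shift_derivE in L.
have L2 := shift_deriv2_Pm4 n.+2.
rewrite [shift_deriv r n.+2]shift_derivE in L2.
have dT := congr1 (@deriv F) (shift_gegenbauer_Pm4 n); rewrite !derivE in dT.
apply: (eq_lincomb (eq_add (eq_mull (2 * w) dT)
  (eq_add (eq_mull (2 * (n%:R + 1)) L2)
  (eq_add (eq_mull (2 * (n%:R + 1)) (solution_shift_deriv _ solution_Pm4 n))
  (eq_add (eq_mull (- (2 * (n%:R + 1) * 'X)) L)
  (eq_add (eq_mull (4 * 'X) (shift_gegenbauer_Pm4 n))
          (eq_mull (- (18 * w)) e0))))))).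
ring.
Qed.

(** The derivative of [deriv_shift_gegenbauer_Pm4], with the derivative of [r n]
    replaced by its value from [deriv_shift_deriv_Pm4]. *)
Lemma ode_Pm4 n (P := Pm4 F n) (c : {poly F} := 'X) (N : {poly F} := n%:R) :
  16 * (c ^+ 2 - 1) ^+ 2 * P^`(4)
  + 160 * c * (c ^+ 2 - 1) * P^`(3)
  - 8 * (c ^+ 2 * (N ^+ 2 - 4 * N - 46) - N ^+ 2 + 4 * N + 22) * P^`(2)
  - 24 * c * (N ^+ 2 - 4 * N - 6) * P^`()
  + (N - 4) ^+ 2 * N ^+ 2 * P = 0.
Proof.
have dC := congr1 (@deriv F) (deriv_shift_gegenbauer_Pm4 n).
have B := deriv_shift_deriv_Pm4 n.
rewrite shift_gegenbauerE !expr2 !derivE in dC; rewrite shift_gegenbauerE in B.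
rewrite /derivn /= /P /c /N.
apply: (eq_lincomb (eq_add (eq_mull 2 dC) (eq_mull ((n%:R - 2) ^+ 2) B))).
ring.
Qed.

End Recursion.

Theorem theorem3p1p1 (R : realType) (n : nat) :
  let P : {poly R[i]} := Pm4 R[i] n in
  let c : {poly R[i]} := 'X in
  let N : {poly R[i]} := n%:R in
  16 * (c ^+ 2 - 1) ^+ 2 * P^`(4)
  + 160 * c * (c ^+ 2 - 1) * P^`(3)
  - 8 * (c ^+ 2 * (N ^+ 2 - 4 * N - 46) - N ^+ 2 + 4 * N + 22) * P^`(2)
  - 24 * c * (N ^+ 2 - 4 * N - 6) * P^`()
  + (N - 4) ^+ 2 * N ^+ 2 * P = 0.
Proof. exact: ode_Pm4. Qed.
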